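(* Let $k,t$ be integers with $1\le t\le k$, let $s_1,\dots,s_k$ and $r_1,\dots,r_k$ be positive integers with $r_i\le s_i$ for all $i$, and put $G=\mathbb{Z}_{s_1}\times\cdots\times\mathbb{Z}_{s_k}$, $H=\mathbb{Z}_{r_1}\times\cdots\times\mathbb{Z}_{r_k}$. Let $A$ be an $\mathrm{OA}(|A|,s_1s_2\cdots s_k,t)$ over $G$ and $B$ an $\mathrm{OA}(|B|,r_1r_2\cdots r_k,t)$ over $H$ such that $A$ contains $B$ as a subarray. Let $\Psi_A=\bigl(\chi_{\mathbf a}(\mathbf x)\bigr)_{\mathbf x\in A,\ \chi_{\mathbf a}\in\mathcal F}$ be the $|A|\times|\mathcal F|$ complex matrix defined in the context, and let $\Psi_A\Psi_A^{H}$ be its Gram matrix, where $\Psi_A^{H}$ is the conjugate transpose of $\Psi_A$. Then: (1) All nonzero eigenvalues of $\Psi_A\Psi_A^{H}$ are equal to $|A|$. (2) Suppose $\frac{s_1}{r_1}=\max\{\frac{s_i}{r_i}:1\le i\le k\}$. If $t$ is even, then $$|A|\ \ge\ |B|\sum_{i=0}^{t/2}\ \sum_{\substack{I\subseteq\{1,\dots,k\}\\ |I|=i}}\ \prod_{j\in I}\Bigl(\frac{s_j}{r_j}-1\Bigr),$$ and if $t$ is odd, then $$|A|\ \ge\ |B|\left[\sum_{i=0}^{\lfloor t/2\rfloor}\ \sum_{\substack{I\subseteq\{1,\dots,k\}\\ |I|=i}}\ \prod_{j\in I}\Bigl(\frac{s_j}{r_j}-1\Bigr)+\Bigl(\frac{s_1}{r_1}-1\Bigr)\sum_{\substack{I\subseteq\{2,\dots,k\}\\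 |I|=\lfloor t/2\rfloor}}\ \prod_{j\in I}\Bigl(\frac{s_j}{r_j}-1\Bigr)\right].$$
   Context: For a positive integer $s$, $\mathbb{Z}_s=\{0,1,\dots,s-1\}$ is the additive group modulo $s$. Since $r_i\le s_i$, the set $H=\prod_i\{0,\dots,r_i-1\}$ is regarded as a subset (not a subgroup) of $G=\prod_i\{0,\dots,s_i-1\}$. Arrays are nonempty finite multisets of rows; $|A|$ is the number of rows counted with multiplicity, and sums or index sets ''$\mathbf x\in A$'' run over rows with multiplicity. For $I=\{i_1,\dots,i_t\}\subseteq\{1,\dots,k\}$ let $G_I=\mathbb{Z}_{s_{i_1}}\times\cdots\times\mathbb{Z}_{s_{i_t}}$ and let $\pi_I:G\to G_I$ be the coordinate projection. For $1\le t\le k$, a finite multiset $A$ of elements of $G$ is an orthogonal array of strength $t$ over $G$, denoted $\mathrm{OA}(|A|,s_1s_2\cdots s_k,t)$, if for every $I\subseteq\{1,\dots,k\}$ with $|I|=t$ there is a positive integer $\lambda_I$ such that $|\{\alpha\in A:\pi_I(\alpha)=\beta\}|=\lambda_I$ for all $\beta\in G_I$ (counted with multiplicity). Here $s_1s_2\cdots s_k$ is the list of numbers of levels, not a product. ''$A$ contains $B$ as a subarray'' means that the rows of $B$ form a sub-multiset of the rows of $A$. For $\mathbf a=(a_1,\dots,a_k)\in G$, $\chi_{\mathbf a}:G\to\mathbb{C}^*$ is the character $\chi_{\mathbf a}(\mathbf x)=\prod_{j=1}^k e^{2\pi i a_jx_j/s_j}$, and $\operatorname{supp}(\mathbf a)=\{j: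 a_j\ne0\}$. The set of characters $\mathcal F$ is $$\mathcal F=\{\chi_{\mathbf a}:\mathbf a\in G,\ |\operatorname{supp}(\mathbf a)|\le t/2\}\quad\text{if } t\text{ is even},$$ $$\mathcal F=\{\chi_{\mathbf a}:|\operatorname{supp}(\mathbf a)|\le\lfloor t/2\rfloor\}\cup\{\chi_{\mathbf a}:|\operatorname{supp}(\mathbf a)|=\lceil t/2\rceil,\ 1\in\operatorname{supp}(\mathbf a)\}\quad\text{if } t\text{ is odd}.$$ The matrix $\Psi_A$ has rows indexed by the rows of $A$ (with multiplicity), columns indexed by $\mathcal F$, and $(\mathbf x,\chi_{\mathbf a})$ entry $\chi_{\mathbf a}(\mathbf x)$. Empty products equal $1$. *)

(* Defs.v *)
From mathcomp Require Import all_boot all_order all_algebra.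
From mathcomp Require Import reals trigo.
From mathcomp Require Import complex.
Set Implicit Arguments.
Unset Strict Implicit.
Unset Printing Implicit Defensive.
Import Order.TTheory GRing.Theory Num.Theory.

Local Open Scope ring_scope.
Local Open Scope sesquilinear_scope.

(* Dependent finite functions, so that the product of the
   Z_(s j) = {0, ..., s j - 1} is a finType even though s varies with j. *)
Definition prodZ (J : finType) (s : J -> nat) : finType :=
  {dffun forall j : J, 'I_(s j)}.

Definition proj (J : finType) (s : J -> nat) (I : {set J}) (x : prodZ s) :
    prodZ (fun j : {j | j \in I} => s (val j)) :=
  [ffun j => x (val j)].

Definition incl (J : finType) (r s : J -> nat) (le_rs : forall j, (r j <= s j)%N)
    (x : prodZ r) : prodZ s :=
  [ffun j => widen_ord (le_rs j) (x j)].

(* A finite multiset of rows is represented by a sequence listing its elements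
   with multiplicity; reordering it only permutes the rows of Psi. *)
Definition orthogonal_array (J : finType) (s : J -> nat) (t : nat)
    (A : seq (prodZ s)) : Prop :=
  (0 < size A)%N /\
  forall I : {set J}, #|I| = t ->
    exists2 lam : nat, (0 < lam)%N &
      forall b : prodZ (fun j : {j | j \in I} => s (val j)),
        count [pred x | proj I x == b] A = lam.

Definition submultiset (T : eqType) (B A : seq T) : Prop :=
  forall x, (count_mem x B <= count_mem x A)%N.

Definition supp (J : finType) (s : J -> nat) (a : prodZ s) : {set J} :=
  [set j | val (a j) != 0%N].

Definition expi (R : realType) (x : R) : R[i] := Complex (cos x) (sin x).

Definition chi (R : realType) (J : finType) (s : J -> nat) (a x : prodZ s) :
    R[i] :=
  \prod_j expi (2 * pi * (a j)%:R * (x j)%:R / (s j)%:R).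

(* The family F of characters, given by its indices: a |-> chi a is injective.
   The first coordinate is ord0. *)
Definition Fset (k t : nat) (s : 'I_k.+1 -> nat) : {set prodZ s} :=
  if odd t then
    [set a | (#|supp a| <= t./2)%N] :|:
    [set a | (#|supp a| == uphalf t) && (ord0 \in supp a)]
  else [set a | (#|supp a| <= t./2)%N].

Definition Psi (R : realType) (k t : nat) (s : 'I_k.+1 -> nat)
    (A : seq (prodZ s)) : 'M[R[i]]_(size A, #|Fset t s|) :=
  \matrix_(x, a) chi R (enum_val a) (tnth (in_tuple A) x).

Definition gram (R : realType) (m n : nat) (M : 'M[R[i]]_(m, n)) : 'M[R[i]]_m :=
  M *m M ^t*.

(* Main.v *)
(** Over an array of strength t, a product of functions of at most t single
    coordinates has the same average as over the whole group G. Hence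
    Psi^H Psi = |A| I, because the union of the supports of two characters in F
    has at most t elements, and every nonzero eigenvalue of Psi Psi^H is an
    eigenvalue of Psi^H Psi.

    For the bound, sum the characters in F to the real reproducing kernel
    K(x, y) = \sum_(a in F) chi_a(x - y). It depends only on where x and y agree
    and satisfies \sum_(z in A) K(x, z) K(z, y) = |A| K(x, y). Let
    f(z) = \sum_(y in B) K(z, y), and let M be the sum in the bound. As B has
    strength t, f is the constant |B| M on B, so
    |B|^3 M^2 = \sum_B f^2 <= \sum_A f^2 = |A| |B|^2 M. *)
Require Import Defs.
From mathcomp Require Import all_boot all_order all_algebra.
From mathcomp Require Import reals trigo.
From mathcomp Require Import complex zify ring lra.
Import Order.TTheory GRing.Theory Num.Theory.
Local Open Scope ring_scope.
Set Implicit Arguments.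
Unset Strict Implicit.
Unset Printing Implicit Defensive.

(** * Averages of product functions over orthogonal arrays *)

Lemma sum_dffun_prod (F : comPzRingType) (I : finType) (T : I -> finType)
    (g : forall i, T i -> F) :
  \sum_(b : {dffun forall i, T i}) \prod_i g i (b i) =
  \prod_i \sum_(c : T i) g i c.
Proof.
rewrite (reindex (@dffun_of_fprod I T)); last exact/onW_bij/dffun_of_fprod_bij.
transitivity (\sum_(b : fprod T) \prod_(i in I) [ffun c => g i c] (b i)).
  by apply: eq_bigr => b _; apply: eq_bigr => i _; rewrite !ffunE.
rewrite (big_fprod _ _ (fun i => [ffun c => g i c])).
(* Ordinary distributivity applies in the tagged sum of all [T i]. The default 0 of [untag] is never
   met, since each inner sum runs over elements tagged [i]. *)
rewrite -(bigA_distr_big_dep (fun i => mem (tagged_with T i))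
  (fun i u => untag 0 [ffun c => g i c] u)).
apply: eq_bigr => i _.
rewrite -(big_tag (fun i => [ffun c => g i c])).
by apply: eq_bigr => c _; rewrite ffunE.
Qed.

(** Strength is defined by sets of exactly [t] coordinates, while the products to be averaged
    involve at most [t]. *)
Lemma subset_card_extend (J : finType) (U : {set J}) (t : nat) :
  (#|U| <= t <= #|J|)%N -> exists2 I : {set J}, U \subset I & #|I| = t.
Proof.
move=> /andP[leUt letJ].
pose s := take (t - #|U|) (enum (~: U)).
have us : uniq s by rewrite take_uniq ?enum_uniq.
have sC : [set:: s] \subset ~: U.
  by apply/subsetP=> j; rewrite inE => /mem_take; rewrite mem_enum.
exists (U :|: [set:: s]); first exact: subsetUl.
rewrite cardsU disjoint_setI0 ?cards0 ?subn0; last first.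
  by rewrite disjoint_sym disjoints_subset.
have -> : #|[set:: s]| = size s by rewrite cardsE (card_uniqP us).
rewrite size_takel ?subnKC //.
by rewrite -cardE -(leq_add2l #|U|) cardsC subnKC.
Qed.

(** On [t] coordinates containing [U] every tuple occurs equally often, so the sum factors; each
    coordinate outside [U] contributes the average 1. *)
Lemma sum_orthogonal_array (F : numFieldType) (J : finType) (s : J -> nat)
    (t : nat) (A : seq (prodZ s)) (U : {set J}) (g : forall j, 'I_(s j) -> F) :
    (forall j, 0 < s j)%N -> orthogonal_array t A -> (#|U| <= t <= #|J|)%N ->
  \sum_(x <- A) \prod_(j in U) g j (x j) =
  (size A)%:R * \prod_(j in U) ((\sum_c g j c) / (s j)%:R).
Proof.
move=> s_gt0 [_ oaA] /subset_card_extend[I sUI cardI].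
have [lam _ countA] := oaA I cardI.
have sumI (h : forall j, 'I_(s j) -> F) :
    \sum_(x <- A) \prod_(j in I) h j (x j) =
    lam%:R * \prod_(j in I) \sum_c h j c.
  transitivity (\sum_(x <- A)
      \prod_(j : {j | j \in I}) h (val j) (proj I x j)).
    apply: eq_bigr => x _; rewrite big_sub.
    by apply: eq_bigr => j _; rewrite ffunE.
  rewrite (partition_big (proj I) predT) //=.
  transitivity (\sum_(b : prodZ (fun j : {j | j \in I} => s (val j)))
      lam%:R * \prod_(j : {j | j \in I}) h (val j) (b j)).
    apply: eq_bigr => b _.
    rewrite (eq_bigr (fun=> \prod_(j : {j | j \in I}) h (val j) (b j))).
      rewrite big_const_seq iter_addr_0 countA.
      by rewrite mulr_natl.
    by move=> x /eqP ->.
  rewrite -mulr_sumr; congr (_ * _).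
  rewrite (sum_dffun_prod (fun j : {j | j \in I} => h (val j))).
  by rewrite [RHS]big_sub.
have s_neq0 j : (s j)%:R != 0 :> F by rewrite pnatr_eq0 -lt0n.
(* Taking all functions equal to 1 expresses [lam] through the number of rows. *)
have sizeA : (size A)%:R = lam%:R * \prod_(j in I) (s j)%:R :> F.
  transitivity (\sum_(x <- A) \prod_(j in I) (1 : F)).
    by rewrite big1_eq big_const_seq iter_addr_0 count_predT.
  rewrite (sumI (fun _ _ => 1)); congr (_ * _).
  by apply: eq_bigr => j _; rewrite sumr_const card_ord.
pose g' j c := if j \in U then g j c else 1.
transitivity (\sum_(x <- A) \prod_(j in I) g' j (x j)).
  apply: eq_bigr => x _; rewrite [RHS](big_setID U) /= (setIidPr sUI).
  rewrite [X in _ = _ * X]big1 ?mulr1.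
    by apply: eq_bigr => j jU; rewrite /g' jU.
  by move=> j; rewrite inE /g' => /andP[/negPf ->].
rewrite sumI sizeA -mulrA; congr (_ * _).
rewrite [RHS](_ : _ = \prod_(j in I) (s j)%:R *
    \prod_(j in I) ((\sum_c g' j c) / (s j)%:R)).
  rewrite -big_split /=; apply: eq_bigr => j _.
  by rewrite mulrCA divff ?mulr1.
congr (_ * _); rewrite [RHS](big_setID U) /= (setIidPr sUI).
rewrite [X in _ = _ * X]big1 ?mulr1.
  by apply: eq_bigr => j jU; rewrite /g' jU.
move=> j; rewrite inE /g' => /andP[/negPf -> _].
by rewrite sumr_const card_ord divff.
Qed.

(** * The reproducing kernel *)

(* The sum of the nontrivial characters of Z_n evaluated at x - y. *)
Definition level_weight (F : pzRingType) (n x y : nat) : F :=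
  n%:R * (x == y)%:R - 1.

(** This is the sum of chi_a(x - y) over all a with support exactly [I], written without complex
    numbers so that it makes sense over an ordered field. *)
Definition support_weight (F : comPzRingType) (J : finType) (s : J -> nat)
    (I : {set J}) (x y : prodZ s) : F :=
  \prod_(j in I) level_weight F (s j) (x j) (y j).

Lemma sum_ord_eq (F : pzSemiRingType) (n : nat) (x : 'I_n) :
  \sum_(c < n) ((x == c :> nat)%:R : F) = 1.
Proof.
rewrite (bigD1 x) //= eqxx big1 ?addr0 // => c.
by rewrite eq_sym => /negPf; rewrite -val_eqE /= => ->.
Qed.

Lemma sum_level_weight (F : comPzRingType) (n : nat) (x : 'I_n) :
  \sum_(c < n) level_weight F n x c = 0.
Proof.
rewrite sumrB -mulr_sumr sum_ord_eq sumr_const card_ord mulr1.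
by rewrite subrr.
Qed.

Lemma level_weightC (F : pzRingType) (n x y : nat) :
  level_weight F n x y = level_weight F n y x.
Proof. by rewrite /level_weight eq_sym. Qed.

(** In matrix form, (nE - J)^2 = n(nE - J), with E the identity and J the all-ones matrix: the rows
    of nE - J sum to 0, so only the diagonal term of the first factor survives. *)
Lemma sum_level_weightM (F : comPzRingType) (n : nat) (x y : 'I_n) :
  \sum_(c < n) level_weight F n x c * level_weight F n c y =
  n%:R * level_weight F n x y.
Proof.
under eq_bigr do rewrite {1}/level_weight mulrBl mul1r -mulrA.
rewrite sumrB -mulr_sumr.
under [X in _ - X]eq_bigr do rewrite level_weightC.
rewrite sum_level_weight subr0 (bigD1 x) //= eqxx mul1r big1 ?addr0 // => c.
by rewrite eq_sym => /negPf; rewrite -val_eqE /= => ->; rewrite mul0r.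
Qed.

(** A coordinate in exactly one of [I] and [I'] averages to 0. If [I = I'], each coordinate
    reproduces its weight, the factor [s j] cancelling against the average. *)
Lemma sum_support_weightM (F : numFieldType) (J : finType) (s : J -> nat)
    (t : nat) (A : seq (prodZ s)) (I I' : {set J}) (x y : prodZ s) :
    (forall j, 0 < s j)%N -> orthogonal_array t A ->
    (#|I :|: I'| <= t <= #|J|)%N ->
  \sum_(z <- A) support_weight F I x z * support_weight F I' z y =
  (size A)%:R * ((I == I')%:R * support_weight F I x y).
Proof.
move=> s_gt0 oaA leU.
have s_neq0 j : (s j)%:R != 0 :> F by rewrite pnatr_eq0 -lt0n.
pose g j (c : 'I_(s j)) : F :=
  (if j \in I then level_weight F (s j) (x j) c else 1) *
  (if j \in I' then level_weight F (s j) c (y j) else 1).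
transitivity (\sum_(z <- A) \prod_(j in I :|: I') g j (z j)).
  apply: eq_bigr => z _; rewrite big_split /=; congr (_ * _).
    rewrite (big_setID I) /= setUK [X in _ = _ * X]big1 ?mulr1.
      by apply: eq_bigr => j ->.
    by move=> j; rewrite inE => /andP[/negPf ->].
  rewrite (big_setID I') /= setUC setUK [X in _ = _ * X]big1 ?mulr1.
    by apply: eq_bigr => j ->.
  by move=> j; rewrite inE => /andP[/negPf ->].
rewrite (sum_orthogonal_array _ s_gt0 oaA leU); congr (_ * _).
case: (eqVneq I I') => [eqI|neqI].
  rewrite mul1r -eqI setUid; apply: eq_bigr => j jI.
  rewrite /g -eqI jI sum_level_weightM mulrC mulrA mulVf ?mul1r //.
rewrite mul0r.
have [j jU gj0] : exists2 j, j \in I :|: I' & \sum_c g j c = 0.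
  have [j jIP] : exists j, (j \in I) != (j \in I').
    apply/existsP; apply: contraNT neqI => /existsPn h.
    by apply/eqP/setP => j; have /negPn/eqP := h j.
  exists j; first by rewrite inE; case: (j \in I) (j \in I') jIP => [] [].
  rewrite /g; case: (j \in I) (j \in I') jIP => [] [] // _.
    by under eq_bigr do rewrite mulr1; exact: sum_level_weight.
  by under eq_bigr do rewrite mul1r level_weightC; exact: sum_level_weight.
by rewrite (bigD1 j) //= gj0 !mul0r.
Qed.

Definition kernel (F : comPzRingType) (J : finType) (s : J -> nat)
    (D : {set {set J}}) (x y : prodZ s) : F :=
  \sum_(I in D) support_weight F I x y.

Lemma sum_kernelM (F : numFieldType) (J : finType) (s : J -> nat) (t : nat)
    (A : seq (prodZ s)) (D : {set {set J}}) (x y : prodZ s) :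
    (forall j, 0 < s j)%N -> (t <= #|J|)%N ->
    {in D &, forall I I', (#|I :|: I'| <= t)%N} -> orthogonal_array t A ->
  \sum_(z <- A) kernel F D x z * kernel F D z y =
  (size A)%:R * kernel F D x y.
Proof.
move=> s_gt0 letJ Dt oaA.
under eq_bigr do rewrite mulr_suml.
rewrite exchange_big /= mulr_sumr; apply: eq_bigr => I ID.
under eq_bigr do rewrite mulr_sumr.
rewrite exchange_big /= (bigD1 I) //= [X in _ + X]big1 ?addr0
  => [|I' /andP[I'D neqI]].
  by rewrite (sum_support_weightM F (t := t)) ?eqxx ?mul1r // letJ Dt.
rewrite (sum_support_weightM F (t := t)) ?letJ ?Dt //.
by rewrite eq_sym (negPf neqI) mul0r mulr0.
Qed.

(** Among the [r j] levels of coordinate [j] in [B], one gives the weight [s j - 1] and the others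
    give -1, so the average is [s j / r j - 1]. *)
Lemma sum_kernel_incl (F : numFieldType) (J : finType) (r s : J -> nat)
    (t : nat) (le_rs : forall j, (r j <= s j)%N) (B : seq (prodZ r))
    (D : {set {set J}}) (x : prodZ r) :
    (forall j, 0 < r j)%N -> (t <= #|J|)%N ->
    {in D, forall I : {set J}, (#|I| <= t)%N} -> orthogonal_array t B ->
  \sum_(y <- B) kernel F D (incl le_rs x) (incl le_rs y) =
  (size B)%:R * \sum_(I in D) \prod_(j in I) ((s j)%:R / (r j)%:R - 1).
Proof.
move=> r_gt0 letJ Dt oaB.
rewrite exchange_big /= mulr_sumr; apply: eq_bigr => I ID.
transitivity (\sum_(y <- B)
    \prod_(j in I) level_weight F (s j) (x j) (y j)).
  by apply: eq_bigr => y _; apply: eq_bigr => j _; rewrite !ffunE.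
rewrite (sum_orthogonal_array (t := t) (U := I)
  (fun j (c : 'I_(r j)) => level_weight F (s j) (x j) c)) ?Dt //.
congr (_ * _); apply: eq_bigr => j _.
rewrite sumrB -mulr_sumr sum_ord_eq sumr_const card_ord mulr1.
by rewrite mulrBl divff // pnatr_eq0 -lt0n.
Qed.

(** * The bound for a subarray *)

Lemma ler_sum_submultiset (F : numDomainType) (T : eqType) (A B : seq T)
    (f : T -> F) :
    (forall x, 0 <= f x) -> submultiset B A ->
  \sum_(x <- B) f x <= \sum_(x <- A) f x.
Proof.
move=> f_ge0 /count_subseqP[A' /perm_to_subseq[A'' permA] permB].
by rewrite (perm_big _ permA) (perm_big _ permB) big_cat lerDl sumr_ge0.
Qed.

Lemma subarray_bound (F : realFieldType) (J : finType) (r s : J -> nat)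
    (t : nat) (le_rs : forall j, (r j <= s j)%N) (A : seq (prodZ s))
    (B : seq (prodZ r)) (D : {set {set J}}) :
    (forall j, 0 < r j)%N -> (t <= #|J|)%N ->
    {in D &, forall I I', (#|I :|: I'| <= t)%N} ->
    orthogonal_array t A -> orthogonal_array t B ->
    submultiset (map (incl le_rs) B) A ->
  (size B)%:R * \sum_(I in D) \prod_(j in I) ((s j)%:R / (r j)%:R - 1)
    <= (size A)%:R :> F.
Proof.
move=> r_gt0 letJ Dt oaA oaB sBA; set M := \sum_(I in D) _.
have s_gt0 j : (0 < s j)%N by apply: leq_trans (le_rs j).
have Dt1 : {in D, forall I : {set J}, (#|I| <= t)%N}.
  by move=> I ID; rewrite -[I]setUid Dt.
have b_gt0 : 0 < (size B)%:R :> F by rewrite ltr0n; case: oaB.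
(* If [M <= 0] the left side is nonpositive; otherwise [M] can be cancelled at the end. *)
have [M_le0|M_gt0] := lerP M 0.
  by apply: (@le_trans _ _ 0); rewrite ?ler0n // mulr_ge0_le0 ?ler0n.
pose i := incl le_rs; pose K (x y : prodZ s) := kernel F D x y.
pose f z := \sum_(y <- B) K z (i y).
have KC x y : K x y = K y x.
  apply: eq_bigr => I _; apply: eq_bigr => j _; exact: level_weightC.
have fB x : f (i x) = (size B)%:R * M.
  by apply: (sum_kernel_incl F le_rs x r_gt0 letJ).
have sumB c : \sum_(x <- B) c = (size B)%:R * c :> F.
  by rewrite big_const_seq iter_addr_0 count_predT mulr_natl.
have sumA : \sum_(z <- A) f z ^+ 2 = (size A)%:R * (size B)%:R ^+ 2 * M.
  (* Expanding the square and moving the sum over [A] inside prepares for the reproducing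
     identity. *)
  transitivity (\sum_(x <- B) \sum_(y <- B)
      \sum_(z <- A) K (i x) z * K z (i y)).
    under [RHS]eq_bigr do rewrite exchange_big.
    rewrite [RHS]exchange_big; apply: eq_bigr => z _ /=.
    rewrite expr2 {1}/f mulr_suml; apply: eq_bigr => x _.
    by rewrite mulr_sumr; apply: eq_bigr => y _; rewrite KC.
  transitivity (\sum_(x <- B) (size A)%:R * f (i x)).
    apply: eq_bigr => x _; rewrite /f mulr_sumr; apply: eq_bigr => y _.
    exact: (sum_kernelM F _ _ s_gt0 letJ Dt oaA).
  under eq_bigr do rewrite fB.
  by rewrite sumB expr2 !mulrA [_ * (size A)%:R]mulrC.
have : \sum_(x <- B) f (i x) ^+ 2 <= \sum_(z <- A) f z ^+ 2.
  rewrite -(big_map i predT (fun z => f z ^+ 2)).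
  by apply: ler_sum_submultiset => // z; rewrite sqr_ge0.
under eq_bigr do rewrite fB.
rewrite sumB sumA; set b := (size B)%:R in b_gt0 *.
(* This exposes the positive common factor [b ^+ 2 * M]. *)
have -> : b * (b * M) ^+ 2 = b * M * (b ^+ 2 * M) by ring.
by rewrite -[leRHS]mulrA ler_pM2r // mulr_gt0 ?exprn_gt0.
Qed.

(** * Roots of unity and orthogonality of characters *)

Lemma expiD (R : realType) (x y : R) : expi (x + y) = expi x * expi y.
Proof.
rewrite /expi cosD sinD; simpc; congr Complex.
by rewrite addrC [X in X + _]mulrC.
Qed.

Lemma expi0 (R : realType) : expi (0 : R) = 1.
Proof. by rewrite /expi cos0 sin0. Qed.

Lemma expi_mulrn (R : realType) (x : R) (n : nat) : expi (x *+ n) = expi x ^+ n.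
Proof. by elim: n => [|n IH]; rewrite ?expi0 // mulrS exprS expiD IH. Qed.

Lemma expi2pi (R : realType) : expi (2 * pi : R) = 1.
Proof. by rewrite mulrC mulr_natr /expi cos2pi sin2pi. Qed.

Lemma conj_expi (R : realType) (x : R) : (expi x)^* = expi (- x).
Proof. by rewrite /expi cosN sinN. Qed.

Lemma conj_expiM (R : realType) (x y : R) : (expi x)^* * expi y = expi (y - x).
Proof. by rewrite addrC expiD conj_expi. Qed.

Lemma expi_neq1 (R : realType) (x : R) : 0 < x < 2 * pi -> expi x != 1.
Proof.
move=> /andP[x_gt0 x_lt]; apply/eqP => -[cosx _].
(* Positivity at x/2 contradicts cos x = 1 - 2 sin^2(x/2) = 1. *)
have : 0 < sin (x / 2).
  by apply: sin_gt0_pi; rewrite divr_gt0 //= ltr_pdivrMr // mulrC.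
suff -> : sin (x / 2) = 0 by rewrite ltxx.
apply/eqP; rewrite -sqrf_eq0 sin2cos2; apply/eqP.
have := cos_mulr2n (x / 2); rewrite (_ : x / 2 *+ 2 = x) ?cosx; lra.
Qed.

Lemma expi_ratio_inj (R : realType) (n : nat) (a b : 'I_n) :
  expi (2 * pi * b%:R / n%:R - 2 * pi * a%:R / n%:R : R) = 1 -> a = b.
Proof.
have n_gt0 : (0 : R) < n%:R by rewrite ltr0n (leq_ltn_trans (leq0n a)).
have pi2_gt0 : (0 : R) < 2 * pi by rewrite mulr_gt0 ?pi_gt0.
have expi_neq (c d : 'I_n) : (c < d)%N ->
    expi (2 * pi * d%:R / n%:R - 2 * pi * c%:R / n%:R : R) != 1.
  move=> ltcd; rewrite -mulrBl -mulrBr -natrB 1?ltnW //.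
  apply: expi_neq1.
  rewrite divr_gt0 ?(mulr_gt0 pi2_gt0) ?ltr0n ?subn_gt0 -?(ltr0n R) //=.
  rewrite ltr_pdivrMr // ltr_pM2l // ltr_nat.
  by rewrite (leq_ltn_trans (leq_subr _ _)).
move=> e1; apply/val_inj; case: (ltngtP a b) => // [/expi_neq/eqP //|/expi_neq].
by rewrite -opprB -conj_expi e1 rmorph1 eqxx.
Qed.

(** This is a geometric sum of powers of [w], where [w ^+ n = 1] and [w = 1] only if [a = b]. *)
Lemma sum_expi_ratio (R : realType) (n : nat) (a b : 'I_n) :
  \sum_(c < n) (expi (2 * pi * a%:R * c%:R / n%:R : R))^* *
    expi (2 * pi * b%:R * c%:R / n%:R) = n%:R * (a == b)%:R.
Proof.
have n_neq0 : n%:R != 0 :> R.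
  by rewrite pnatr_eq0 -lt0n (leq_ltn_trans (leq0n a)).
pose w := expi (2 * pi * b%:R / n%:R - 2 * pi * a%:R / n%:R : R).
transitivity (\sum_(c < n) w ^+ c).
  apply: eq_bigr => c _; rewrite conj_expiM -expi_mulrn.
  by congr expi; rewrite -[_ *+ c]mulr_natr; ring.
have [eqab|neqab] := eqVneq a b.
  rewrite mulr1 (eq_bigr (fun=> 1)) ?sumr_const ?card_ord // => c _.
  by rewrite /w eqab subrr expi0 expr1n.
rewrite mulr0; have := subrX1 w n.
have -> : w ^+ n = 1.
  have -> : w = (expi (2 * pi * a%:R / n%:R : R))^* *
      expi (2 * pi * b%:R / n%:R).
    by rewrite conj_expiM.
  have e1 (m : nat) : expi (2 * pi * m%:R / n%:R : R) ^+ n = 1.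
    rewrite -expi_mulrn -[_ *+ n]mulr_natr divfK // mulr_natr expi_mulrn.
    by rewrite expi2pi expr1n.
  by rewrite exprMn -rmorphXn !e1 rmorph1 mulr1.
rewrite subrr => /esym/eqP; rewrite mulf_eq0 subr_eq0 => /orP[/eqP w1|/eqP //].
by move/eqP: neqab; case; exact: expi_ratio_inj w1.
Qed.

(** Outside both supports the factors are 1, so at most [t] coordinates matter. A coordinate where
    [a] and [b] differ lies in the union of the supports and averages to 0. *)
Lemma sum_chi (R : realType) (J : finType) (s : J -> nat) (t : nat)
    (A : seq (prodZ s)) (a b : prodZ s) :
    (forall j, 0 < s j)%N -> orthogonal_array t A ->
    (#|supp a :|: supp b| <= t <= #|J|)%N ->
  \sum_(x <- A) (chi R a x)^* * chi R b x = (size A)%:R * (a == b)%:R.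
Proof.
move=> s_gt0 oaA leU.
pose g j (c : 'I_(s j)) := (expi (2 * pi * (a j)%:R * c%:R / (s j)%:R : R))^* *
  expi (2 * pi * (b j)%:R * c%:R / (s j)%:R).
transitivity (\sum_(x <- A) \prod_(j in supp a :|: supp b) g j (x j)).
  apply: eq_bigr => x _; rewrite rmorph_prod -big_split /= [RHS]big_mkcond.
  apply: eq_bigr => j _; case: ifPn => //.
  rewrite !inE negb_or !negbK => /andP[/eqP -> /eqP ->].
  by rewrite !(mulr0, mul0r) expi0 rmorph1 mulr1.
rewrite (sum_orthogonal_array _ s_gt0 oaA leU); congr (_ * _).
have s_neq0 j : (s j)%:R != 0 :> R[i] by rewrite pnatr_eq0 -lt0n.
have [eqab|neqab] := eqVneq a b.
  apply: big1 => j _.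
  by rewrite sum_expi_ratio eqab eqxx mulr1 divff.
have [j neqj] : exists j, a j != b j.
  apply/existsP; apply: contraNT neqab => /existsPn h.
  by apply/eqP/ffunP => j; have /negPn/eqP := h j.
rewrite (bigD1 j) /=; first by rewrite sum_expi_ratio (negPf neqj) mulr0 !mul0r.
rewrite !inE; apply: contraNT neqj.
rewrite negb_or !negbK => /andP[/eqP a0 /eqP b0].
by apply/eqP/val_inj; rewrite a0 b0.
Qed.

(** * The family of supports and the spectrum of the Gram matrix *)

(* The supports of the indices of the characters in F. *)
Definition supports (k t : nat) : {set {set 'I_k.+1}} :=
  [set I : {set 'I_k.+1} | (#|I| <= t./2)%N ||
    [&& odd t, #|I| == uphalf t & ord0 \in I]].

Lemma in_Fset (k t : nat) (s : 'I_k.+1 -> nat) (a : prodZ s) :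
  (a \in Fset t s) = (supp a \in supports k t).
Proof. by rewrite /Fset inE; case: (odd t); rewrite !inE ?orbF. Qed.

(** The critical case is [t] odd with both sets of size [uphalf t]: they share [ord0], so the union
    has at most 2 [uphalf t] - 1 = [t] elements. *)
Lemma card_supportsU (k t : nat) :
  {in supports k t &, forall I I' : {set 'I_k.+1}, (#|I :|: I'| <= t)%N}.
Proof.
move=> I I'; rewrite !inE.
have := cardsUI I I'; have := cardsD1 ord0 (I :&: I'); rewrite inE.
have := odd_double_half t; rewrite uphalf_half -addnn.
move: (odd t) (ord0 \in I) (ord0 \in I') t./2 => o b b' h.
move: #|_ :\ _| #|I :&: I'| #|I :|: I'| #|I| #|I'| => m mI mU n n'.
by case: o b b' => [] [] [] /=; rewrite ?andbF ?andbT ?orbF; lia.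
Qed.

(** If the row vector [v] is an eigenvector for the Gram matrix, then [v *m M] is one for the
    product in the other order, and [z != 0] keeps it nonzero. *)
Lemma gram_eigenvalue (C : numClosedFieldType) (m n : nat) (M : 'M[C]_(m, n))
    (c z : C) :
    map_mx Num.conj M^T *m M = c%:M ->
    eigenvalue (M *m map_mx Num.conj M^T) z -> z != 0 ->
  z = c.
Proof.
move=> MM /eigenvalueP[v vz v_neq0] z_neq0.
have vM_neq0 : v *m M != 0.
  apply: contraNneq v_neq0 => vM0; have := vz; rewrite mulmxA vM0 mul0mx.
  by move/esym/eqP; rewrite scaler_eq0 (negPf z_neq0).
have : z *: (v *m M) = c *: (v *m M).
  by rewrite scalemxAl -vz -!mulmxA MM -mul_mx_scalar mulmxA.
move/eqP; rewrite -subr_eq0 -scalerBl scaler_eq0 (negPf vM_neq0) orbF subr_eq0.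
by move/eqP.
Qed.

Lemma sum_supports (R : pzRingType) (k t : nat) (f : {set 'I_k.+1} -> R) :
  \sum_(I in supports k t) f I =
  \sum_(0 <= i < t./2.+1) \sum_(I : {set 'I_k.+1} | #|I| == i) f I +
  (if odd t then
    \sum_(I : {set 'I_k.+1} | (ord0 \notin I) && (#|I| == t./2)) f (ord0 |: I)
   else 0).
Proof.
rewrite (bigID (fun I : {set 'I_k.+1} => #|I| <= t./2)%N) /=; congr (_ + _).
  rewrite big_mkord.
  rewrite (partition_big (fun I : {set 'I_k.+1} =>
    (* On the sets summed here the size is at most [t./2], so [inord] does not truncate. *)
    inord #|I| : 'I_t./2.+1) predT) //=.
  apply: eq_bigr => i _; apply: eq_bigl => I; rewrite inE.
  case: leqP => /= [leI|gtI]; first by rewrite -val_eqE /= inordK.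
  rewrite andbF; apply/esym/negbTE.
  by apply: contraTneq gtI => ->; rewrite -leqNgt -ltnS.
case: ifP => odd_t; last by rewrite big1 // => I; rewrite inE odd_t orbF andbN.
(* The remaining sets have size [t./2 + 1] and contain [ord0]; removing it is a bijection onto the
   sets of size [t./2] avoiding [ord0]. *)
rewrite (reindex_onto (fun I => ord0 |: I) (fun I => I :\ ord0)) /=; last first.
  move=> I; rewrite inE odd_t; case: (#|I| <= _)%N => //= /andP[/andP[_ oI] _].
  by rewrite setD1K.
apply: eq_bigl => I; rewrite !inE odd_t eqxx /= cardsU1 uphalf_half odd_t.
have [oI|oI] /= := boolP (ord0 \in I).
  rewrite [X in _ && X](_ : _ = false) ?andbF //; apply/eqP => /setP/(_ ord0).
  by rewrite !inE oI.
by rewrite setU1K // eqxx andbT andbT; lia.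
Qed.

Theorem theorem4p5 (R : realType) (k t : nat) (s r : 'I_k.+1 -> nat)
    (t_gt0 : (1 <= t)%N) (t_le : (t <= k.+1)%N)
    (s_gt0 : forall i, (0 < s i)%N) (r_gt0 : forall i, (0 < r i)%N)
    (le_rs : forall i, (r i <= s i)%N)
    (A : seq (prodZ s)) (B : seq (prodZ r))
    (OA_A : orthogonal_array t A) (OA_B : orthogonal_array t B)
    (sub_BA : submultiset (map (incl le_rs) B) A) :
  let q (i : 'I_k.+1) : R := (s i)%:R / (r i)%:R in
  (forall z : R[i],
      eigenvalue (gram (Psi R t A)) z -> z != 0 -> z = (size A)%:R)
  /\
  ((forall i, q i <= q ord0) ->
   (~~ odd t ->
      (size A)%:R >= (size B)%:R *
        \sum_(0 <= i < (t./2).+1) \sum_(I : {set 'I_k.+1} | #|I| == i)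
          \prod_(j in I) (q j - 1))
   /\
   (odd t ->
      (size A)%:R >= (size B)%:R *
        (\sum_(0 <= i < (t./2).+1) \sum_(I : {set 'I_k.+1} | #|I| == i)
           \prod_(j in I) (q j - 1)
         + (q ord0 - 1) *
           \sum_(I : {set 'I_k.+1} | (ord0 \notin I) && (#|I| == t./2))
             \prod_(j in I) (q j - 1)))).
Proof.
move=> q; split.
  move=> z; apply: gram_eigenvalue; apply/matrixP => a b; rewrite !mxE.
  transitivity (\sum_(x <- A) (chi R (enum_val a) x)^* * chi R (enum_val b) x).
    rewrite [RHS]big_tnth; apply: eq_bigr => x _; rewrite !mxE.
    by rewrite !(tnth_nth (enum_val a)).
  rewrite (sum_chi R s_gt0 OA_A) ?(inj_eq enum_val_inj) ?mulr_natr //.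
  by rewrite card_ord t_le card_supportsU // -in_Fset enum_valP.
move=> _.
have := @subarray_bound R 'I_k.+1 r s t le_rs A B (supports k t) r_gt0.
rewrite card_ord => /(_ t_le (@card_supportsU k t) OA_A OA_B sub_BA).
rewrite sum_supports => bound; split=> [/negPf|] odd_t.
  by move: bound; rewrite odd_t addr0.
move: bound; rewrite odd_t mulr_sumr.
(* Each product over [ord0 |: I] splits off the factor [q ord0 - 1]. *)
under [X in _ + X]eq_bigr => I /andP[oI _] do
  rewrite big_setU1 //.
by [].
Qed.
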